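(* Let $R$ be a finite chain ring of length $2$ with residue field $\mathbb{F}_q$, and let $n=2q+t$ with $0\le t\le q-2$. Then $$\mathrm{m}_n(R)\ge\begin{cases} q(q+1)n-q^3+2q^2-4q-2t & \text{if } t\le q-5,\\ q(q+1)n-q^3+2q^2-8q+16 & \text{if } t=q-4,\\ q(q+1)n-q^3+q^2-2q & \text{if } t=q-3,\\ q(q+1)n-q^3 & \text{if } t=q-2.\end{cases}$$ Equivalently, there exist projective $\bigl(q^3+(t+4)q^2+(t-4)q-2t,\,2q+t\bigr)$-arcs for $0\le t\le q-5$, and (whenever the respective $t=q-4,q-3,q-2$ is nonnegative) projective $(2q^3+q^2-12q+16,\,3q-4)$-, $(2q^3+q^2-5q,\,3q-3)$- and $(2q^3+q^2-2q,\,3q-2)$-arcs in $\mathrm{PHG}(2,R)$.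
   Context: Throughout, $R$ is a finite chain ring of nilpotency index (length) $2$, i.e. a finite local ring with radical $\mathrm{rad}R\neq 0$, $(\mathrm{rad}R)^2=0$, whose one-sided ideals form the chain $R\supsetneq\mathrm{rad}R\supsetneq 0$, with residue field $R/\mathrm{rad}R\cong\mathbb{F}_q$ ($q$ a prime power); then $|R|=q^2$. The projective Hjelmslev plane $\mathrm{PHG}(2,R)$ is the incidence structure whose points are the free rank-$1$ submodules of the right module $R_R^3$, whose lines are the free rank-$2$ submodules of $R_R^3$, with incidence given by inclusion; it has $q^4+q^3+q^2$ points and each line contains $q^2+q$ points. A $(k,n)$-arc is a map $\mathcal{K}$ from the point set to $\mathbb{N}_0$ with $\sum_x\mathcal{K}(x)=k$ and $\sum_{x\in L}\mathcal{K}(x)\le n$ for every line $L$; it is projective if $\mathcal{K}$ takes only values in $\{0,1\}$ (i.e. it is a set of $k$ points meeting every line in at most $n$ points). For $0\le n\le q^2+q$, $\mathrm{m}_n(R)$ denotes the largest $k$ such that a projective $(k,n)$-arc exists in $\mathrm{PHG}(2,R)$. *)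

(* Defs.v *)
From HB Require Import structures.
From mathcomp Require Import all_boot all_order all_algebra.
Set Implicit Arguments.
Unset Strict Implicit.
Unset Printing Implicit Defensive.
Import GRing.Theory.
Local Open Scope ring_scope.

Section ChainRing.
Variable R : finNzRingType.

Definition left_ideal (I : {set R}) : Prop :=
  [/\ 0 \in I, (forall x y, x \in I -> y \in I -> x + y \in I)
    & (forall r x, x \in I -> r * x \in I)].

Definition right_ideal (I : {set R}) : Prop :=
  [/\ 0 \in I, (forall x y, x \in I -> y \in I -> x + y \in I)
    & (forall r x, x \in I -> x * r \in I)].

(* R is a finite chain ring of nilpotency index 2 with radical N:
   the left ideals are exactly R ⊋ N ⊋ 0, likewise the right ideals,
   and N^2 = 0.  (N is then necessarily rad R, the unique maximal
   one-sided ideal.) *)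
Definition chain_ring2 (N : {set R}) : Prop :=
  [/\ (forall I, left_ideal I <-> (I = [set 0] \/ I = N \/ I = setT)),
      (forall I, right_ideal I <-> (I = [set 0] \/ I = N \/ I = setT)),
      N != [set 0], N != setT
    & (forall x y, x \in N -> y \in N -> x * y = 0)].

Definition vec := 'rV[R]_3.

Definition rmul (x : vec) (r : R) : vec := \row_i (x ord0 i * r).

Definition span1 (x : vec) : {set vec} := [set rmul x r | r : R].
Definition span2 (x y : vec) : {set vec} :=
  [set rmul x rs.1 + rmul y rs.2 | rs : R * R].

(* free rank-1 submodules: xR with {x} a basis *)
Definition is_point (P : {set vec}) : bool :=
  [exists x : vec, (P == span1 x) && injectiveb (rmul x)].

(* free rank-2 submodules: xR + yR with {x, y} a basis *)
Definition is_line (L : {set vec}) : bool :=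
  [exists x : vec, exists y : vec,
     (L == span2 x y) &&
     injectiveb (fun rs : R * R => rmul x rs.1 + rmul y rs.2)].

Definition proj_arc (K : {set {set vec}}) (n : nat) : bool :=
  [forall P in K, is_point P] &&
  [forall L : {set vec}, is_line L ==> (#|[set P in K | P \subset L]| <= n)%N].

Definition m_n (n : nat) : nat :=
  (\max_(K : {set {set vec}} | proj_arc K n) #|K|)%N.

End ChainRing.

(* Main.v *)
Require Import Defs.
From HB Require Import structures.
From mathcomp Require Import all_boot all_order all_algebra.
From mathcomp Require Import finfield zify ring.
Set Implicit Arguments.
Unset Strict Implicit.
Unset Printing Implicit Defensive.
Import GRing.Theory.
Local Open Scope ring_scope.

(** Let F = R/N, q = |F| and s = q - 2 - t.  Every neighbour class of points is
an affine plane of order q, which a line meets in an affine line whose direction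
depends only on the neighbour class of that line.  Fix a line class M and a point
class x0 on M, and take M as the line at infinity of the factor plane PG(2,q),
with the lines through x0 as the vertical ones.  Fix a set A of s elements of F.
- In an affine class (a, b) with a not in A, take two parallel segments of
  slope a.  A line of slope m meets it in 2 points, except if a = m, when the
  intersection has q or 0 points.
- In an affine class (a, b) with a in A, take one vertical segment, chosen so
  that the q segments of column a lie on a parabola in the dual plane of that
  vertical line class.  A vertical line then contains at most two of them, and
  every other line meets each of these classes in one point.
- In the classes at infinity with slope m in A, take points on q - 2 segments of
  direction M, and in x0 a set meeting every vertical line in at most t points.
A line of slope m not in A has at most s + 2(q - s - 1) + q = 2q + t points, one of
slope m in A at most s + 2(q - s) + (q - 2) = 2q + t, a vertical one at most 2q + t.
The points at infinity are chosen to be as many as the lines in the class M allow: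
two classes with q points per segment and one with t if s >= 3; for s <= 2 fewer
slopes are available and x0 is used instead. *)

(** * Units, radical and residue field of a chain ring of length 2 *)

Section ChainRingTheory.
Variables (R : finNzRingType) (N : {set R}).
Hypothesis chainN : chain_ring2 N.

Lemma rad_left : left_ideal N.
Proof. by case: chainN => lN _ _ _ _; apply/lN; right; left. Qed.

Lemma rad_right : right_ideal N.
Proof. by case: chainN => _ rN _ _ _; apply/rN; right; left. Qed.

Lemma rad0 : 0 \in N. Proof. by case: rad_left. Qed.

Lemma radD x y : x \in N -> y \in N -> x + y \in N.
Proof. by case: rad_left => _ + _; apply. Qed.

Lemma radMl r x : x \in N -> r * x \in N.
Proof. by case: rad_left => _ _; apply. Qed.

Lemma radMr r x : x \in N -> x * r \in N.
Proof. by case: rad_right => _ _; apply. Qed.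

Lemma radN x : x \in N -> - x \in N.
Proof. by rewrite -mulN1r; apply: radMl. Qed.

Lemma radB x y : x \in N -> y \in N -> x - y \in N.
Proof. by move=> Nx Ny; apply/radD/radN. Qed.

Lemma rad_mul0 x y : x \in N -> y \in N -> x * y = 0.
Proof. by case: chainN => _ _ _ _; apply. Qed.

Lemma left_ideal_gen (x : R) : left_ideal [set r * x | r : R].
Proof.
split=> [|_ _ /imsetP[r _ ->] /imsetP[s _ ->]|r _ /imsetP[s _ ->]].
- by apply/imsetP; exists 0; rewrite ?mul0r.
- by rewrite -mulrDl; apply: imset_f.
- by rewrite mulrA; apply: imset_f.
Qed.

Lemma right_ideal_gen (x : R) : right_ideal [set x * r | r : R].
Proof.
split=> [|_ _ /imsetP[r _ ->] /imsetP[s _ ->]|r _ /imsetP[s _ ->]].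
- by apply/imsetP; exists 0; rewrite ?mulr0.
- by rewrite -mulrDr; apply: imset_f.
- by rewrite -mulrA; apply: imset_f.
Qed.

(** The ideals [R x] and [x R] contain [x], so they are neither 0 nor N and must be all of R. The
    left and right inverses obtained this way coincide. *)
Lemma nonrad_inv x : x \notin N -> exists2 u, u * x = 1 & x * u = 1.
Proof.
case: chainN => lN rN _ _ _ Nx.
have xnz : x != 0 by apply: contraNneq Nx => ->; apply: rad0.
have [u ux1] : exists u, u * x = 1.
  have Ix : x \in [set r * x | r : R] by apply/imsetP; exists 1; rewrite ?mul1r.
  case/lN: (left_ideal_gen x) => [E|[E|E]].
  - by rewrite E inE (negPf xnz) in Ix.
  - by rewrite E (negPf Nx) in Ix.
  - by have := in_setT (1 : R); rewrite -E => /imsetP[u _ ->]; exists u.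
have [v xv1] : exists v, x * v = 1.
  have Ix : x \in [set x * r | r : R] by apply/imsetP; exists 1; rewrite ?mulr1.
  case/rN: (right_ideal_gen x) => [E|[E|E]].
  - by rewrite E inE (negPf xnz) in Ix.
  - by rewrite E (negPf Nx) in Ix.
  - by have := in_setT (1 : R); rewrite -E => /imsetP[v _ ->]; exists v.
have uv : u = v by rewrite -[u]mulr1 -xv1 mulrA ux1 mul1r.
by exists u; rewrite // uv.
Qed.

Lemma rad1 : 1 \notin N.
Proof.
case: chainN => _ _ _ NT _; apply: contra NT => N1.
by apply/eqP/setP=> x; rewrite inE -[x]mulr1 radMl.
Qed.

(** Any nonzero element of N works: the one-sided ideals it generates are nonzero, and they lie in
    N, which does not contain 1; so the chain condition makes them equal to N. *)
Lemma rad_gen : exists theta, [/\ theta \in N, theta != 0,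
  forall x, x \in N -> exists r, x = r * theta &
  forall x, x \in N -> exists r, x = theta * r].
Proof.
case: chainN => lN rN N0 _ _.
have /subsetPn[th Nth] : ~~ (N \subset [set 0]).
  by apply: contra N0 => sN; rewrite eqEsubset sN sub1set rad0.
rewrite inE => thnz; exists th; split=> // x Nx.
  have Ith : th \in [set r * th | r : R] by apply/imsetP; exists 1; rewrite ?mul1r.
  case/lN: (left_ideal_gen th) => [E|[E|E]].
  - by rewrite E inE (negPf thnz) in Ith.
  - by move: Nx; rewrite -{1}E => /imsetP[r _ ->]; exists r.
  - have := in_setT (1 : R); rewrite -E => /imsetP[r _ r1].
    by have := rad1; rewrite r1 radMl.
have Ith : th \in [set th * r | r : R] by apply/imsetP; exists 1; rewrite ?mulr1.
case/rN: (right_ideal_gen th) => [E|[E|E]].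
- by rewrite E inE (negPf thnz) in Ith.
- by move: Nx; rewrite -{1}E => /imsetP[r _ ->]; exists r.
- have := in_setT (1 : R); rewrite -E => /imsetP[r _ r1].
  by have := rad1; rewrite r1 radMr.
Qed.

(** A canonical representative of the coset x + N: the choice depends only on the predicate, hence
    only on the coset. The default never occurs, as [x] itself qualifies. *)
Definition rad_repr x := odflt x [pick y | x - y \in N].

Lemma rad_reprB x : x - rad_repr x \in N.
Proof.
by rewrite /rad_repr; case: pickP => //= /(_ x); rewrite subrr rad0.
Qed.

Lemma rad_repr_eq x y : (rad_repr x == rad_repr y) = (x - y \in N).
Proof.
apply/eqP/idP=> [E|Nxy].
  have := radB (rad_reprB x) (rad_reprB y); rewrite E.
  by rewrite opprB addrA subrK.
rewrite /rad_repr; have E: (fun z => x - z \in N) =1 (fun z => y - z \in N).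
  move=> z; apply/idP/idP=> Nz.
    by have := radB Nz Nxy; rewrite opprB addrC addrA addrNK.
  by have := radD Nxy Nz; rewrite addrA subrK.
rewrite (eq_pick E); case: pickP => //= /(_ y).
by rewrite subrr rad0.
Qed.

Lemma rad_reprK x : rad_repr (rad_repr x) = rad_repr x.
Proof. by apply/eqP; rewrite rad_repr_eq -opprB radN // rad_reprB. Qed.

(** The carrier is the set of fixed points of [rad_repr], one per coset. The quotient is a domain
    because elements outside N are invertible, and Wedderburn's theorem, through
    [FinDomainFieldType], makes this finite domain a field. *)
Lemma residue_field : exists (F : finFieldType) (pi : {rmorphism R -> F}),
  (forall a, exists x, pi x = a) /\ forall x, (pi x == 0) = (x \in N).
Proof.
pose T := {x : R | rad_repr x == x}.
have TP x : rad_repr (rad_repr x) == rad_repr x by rewrite rad_reprK.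
pose pi x : T := exist (fun y => rad_repr y == y) (rad_repr x) (TP x).
have piE x y : (pi x == pi y) = (x - y \in N).
  by rewrite -val_eqE /= rad_repr_eq.
have piP x y : x - y \in N -> pi x = pi y by rewrite -piE => /eqP.
have piK (a : T) : pi (val a) = a by apply/val_inj/eqP; case: a.
have valpi x : x - val (pi x) \in N by exact: rad_reprB.
have valpi' x : val (pi x) - x \in N by rewrite -opprB radN.
pose add (a b : T) := pi (val a + val b).
pose opp (a : T) := pi (- val a).
pose mul (a b : T) := pi (val a * val b).
have addE x y : add (pi x) (pi y) = pi (x + y).
  by apply: piP; rewrite opprD addrACA; apply: radD.
have oppE x : opp (pi x) = pi (- x).
  by apply: piP; rewrite -opprD; apply/radN/valpi'.
have mulE x y : mul (pi x) (pi y) = pi (x * y).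
  apply: piP; rewrite -(subrK (x * val (pi y)) (_ * _)) -mulrBl -addrA -mulrBr.
  by apply: radD; [apply: radMr | apply: radMl].
have addA : associative add.
  by move=> a b c; rewrite -[a]piK -[b]piK -[c]piK !addE addrA.
have addC : commutative add by move=> a b; rewrite /add addrC.
have add0 : left_id (pi 0) add by move=> a; rewrite -[a]piK addE add0r.
have addN : left_inverse (pi 0) opp add.
  by move=> a; rewrite -[a]piK oppE addE addNr.
have mulA : associative mul.
  by move=> a b c; rewrite -[a]piK -[b]piK -[c]piK !mulE mulrA.
have mul1 : left_id (pi 1) mul by move=> a; rewrite -[a]piK mulE mul1r.
have mulr1' : right_id (pi 1) mul by move=> a; rewrite -[a]piK mulE mulr1.
have mulDl : left_distributive mul add.
  by move=> a b c; rewrite -[a]piK -[b]piK -[c]piK !(mulE, addE) mulrDl.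
have mulDr : right_distributive mul add.
  by move=> a b c; rewrite -[a]piK -[b]piK -[c]piK !(mulE, addE) mulrDr.
have onz : pi 1 != pi 0 by rewrite piE subr0 rad1.
pose Zm := GRing.isZmodule.Build T addA addC add0 addN.
pose ZT : zmodType := HB.pack T Zm.
pose Rm := GRing.Zmodule_isNzRing.Build ZT mulA mul1 mulr1' mulDl mulDr onz.
pose RT : finNzRingType := HB.pack T Zm Rm.
pose UT : finUnitRingType := HB.pack RT (FinRing.isNzRing.Build RT).
have dom : GRing.integral_domain_axiom UT.
  move=> a b; rewrite -[a]piK -[b]piK; move/eqP.
  rewrite -[_ * _]/(mul _ _) mulE -[0]/(pi 0) piE subr0 => Nab.
  have [Na|/nonrad_inv[u ua _]] := boolP (val a \in N).
    by rewrite piE subr0 Na.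
  by rewrite orbC piE subr0 -[val b]mul1r -ua -mulrA radMl.
pose F := FinDomainFieldType dom.
pose f : R -> F := pi.
have fB : zmod_morphism f.
  by move=> x y; rewrite /f -addE -oppE.
have fM : monoid_morphism f by split=> // x y; rewrite /f -mulE.
pose g : {rmorphism R -> F} :=
  HB.pack f (GRing.isZmodMorphism.Build _ _ f fB)
          (GRing.isMonoidMorphism.Build _ _ f fM).
exists F, g; split=> [a|x]; first by exists (val a); apply: piK.
by rewrite -[0]/(pi 0) /= piE subr0.
Qed.

End ChainRingTheory.

(** * Counting on sums and products of finite types *)

Section Counting.
Variables T U : finType.

Lemma card_sum_pred (D : pred (T + U)) :
  #|D| = (#|[pred x | D (inl x)]| + #|[pred y | D (inr y)]|)%N.
Proof.
rewrite -!sum1_card (eq_bigl D) // big_sumType /=.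
by congr addn; apply: eq_bigl.
Qed.

Lemma card_pair_pred (D : pred (T * U)) :
  (#|D| = \sum_x #|[pred y | D (x, y)]|)%N.
Proof.
rewrite -sum1_card (eq_bigl (fun p => true && D (p.1, p.2))) => [|[x y]] //.
rewrite -(pair_big_dep predT (fun x y => D (x, y)) (fun _ _ => 1%N)) /=.
by apply: eq_bigr => x _; rewrite -sum1_card.
Qed.

Lemma leq_card_cancel (D : pred T) (E : pred U) (f : T -> U) (g : U -> T) :
  (forall x, D x -> g (f x) = x /\ E (f x)) -> (#|D| <= #|E|)%N.
Proof.
move=> fgD; have injf : {in D &, injective f}.
  by move=> x y /fgD[Ex _] /fgD[Ey _] Exy; rewrite -Ex -Ey Exy.
rewrite -(card_in_imset injf); apply/subset_leq_card/subsetP=> y.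
by case/imsetP=> x /fgD[_ Ex] ->.
Qed.

End Counting.

Lemma exists_subset_card (T : finType) (A : {set T}) k :
  (k <= #|A|)%N -> exists2 B : {set T}, B \subset A & #|B| = k.
Proof.
move=> lekA; exists [set x in take k (enum A)].
  by apply/subsetP=> x; rewrite inE => /mem_take; rewrite mem_enum.
rewrite cardsE (card_uniqP (take_uniq _ (enum_uniq _))) size_take -cardE.
by case: ltngtP lekA.
Qed.

(** * The arc over F: its size and its intersections with traces of lines *)

Section ArcCoordinates.
Variables (F : finFieldType) (tau : {additive F -> F}).
Hypothesis tau_inj : injective tau.
Variables (A : {set F}) (Pinf : F -> F -> F -> bool) (P0 : F -> F -> bool).
Local Notation q := #|F|.

(* The three summands index the points (X, Y, 1), (1, Y, Z) and (X, 1, Z), with Z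
   (resp. X and Z) in the radical.  Here (a, b, x, y) stands for X = a + x theta and
   Y = b + y theta, (m, u, v) for Y = m + u theta and Z = v theta, and (u, v) for
   X = u theta and Z = v theta, with N generated by theta. *)
Definition hpoint : Type := (F * F * F * F + F * F * F + F * F)%type.

(** For a in A, a vertical line cuts class (a, b) in the segment x = [tau (d * b) + k], where [tau]
    comes from moving [theta] past scalars of a noncommutative R. Hence the dual parabola carries
    the same twist. *)
Definition arc_aff a b x y :=
  if a \in A then x == tau (b ^+ 2) else (y == a * x) || (y == a * x + 1).

Definition arc_point (i : hpoint) : bool :=
  match i with
  | inl (inl (a, b, x, y)) => arc_aff a b x y
  | inl (inr (m, u, v)) => Pinf m u v
  | inr (u, v) => P0 u v
  end.

(* The traces of the lines Y = mu X + ka Z, of X = de Y + ka Z with de in N, and of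
   Z = de X + ep Y with de and ep in N. *)
Definition on_slope m c (e : F -> F) k (i : hpoint) : bool :=
  match i with
  | inl (inl (a, b, x, y)) => (b == m * a + c) && (y == m * x + e a)
  | inl (inr (m', u, v)) => (m' == m) && (u == k + c * v)
  | inr _ => false
  end.

Definition on_vert a d k l (i : hpoint) : bool :=
  match i with
  | inl (inl (a', b, x, _)) => (a' == a) && (x == tau (d * b) + k)
  | inl (inr _) => false
  | inr (u, v) => u == l + a * v
  end.

Definition on_far (h : F -> F) e (i : hpoint) : bool :=
  match i with
  | inl (inl _) => false
  | inl (inr (m, _, v)) => v == h m
  | inr (_, v) => v == e
  end.

Lemma card_arc_point :
  #|arc_point| = ((#|A| + 2 * #|~: A|) * q ^ 2
            + \sum_m \sum_u #|[pred v | Pinf m u v]|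
            + \sum_u #|[pred v | P0 u v]|)%N.
Proof.
rewrite !card_sum_pred !card_pair_pred /=; congr (_ + _ + _)%N; last first.
  rewrite (pair_bigA _ (fun m u => #|[pred v | Pinf m u v]|)).
  by apply: eq_bigr => -[m u] _; apply: eq_card.
transitivity (\sum_a \sum_b \sum_x #|[pred y | arc_aff a b x y]|)%N.
  rewrite (pair_bigA _ (fun a b => \sum_x #|[pred y | arc_aff a b x y]|)%N) /=.
  rewrite (pair_bigA _ (fun p x => #|[pred y | arc_aff p.1 p.2 x y]|)) /=.
  by apply: eq_bigr => -[[a b] x] _; apply: eq_card.
rewrite (eq_bigr (fun a => if a \in A then q ^ 2 else 2 * q ^ 2)%N) => [|a _].
  rewrite big_if /= !sum_nat_const mulnDl -mulnA; congr (_ + _)%N.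
  by rewrite mulnCA; congr (_ * (_ * _))%N; apply: eq_card => a; rewrite !inE.
transitivity (\sum_(b : F) (if a \in A then q else 2 * q))%N; last first.
  by rewrite sum_nat_const -mulnn; case: ifP => _ //; rewrite mulnCA.
apply: eq_bigr => b _; rewrite /arc_aff; case: ifP => aA.
  rewrite (bigD1 (tau (b ^+ 2))) //= big1 => [|x /negPf ->].
    by rewrite addn0; apply: eq_card => y; rewrite !inE eqxx.
  by apply: eq_card0 => y; rewrite !inE.
rewrite (eq_bigr (fun _ => 2)) ?sum_nat_const 1?mulnC // => x _.
have nz : a * x != a * x + 1.
  by rewrite -[X in X != _]addr0 (inj_eq (addrI _)) eq_sym oner_eq0.
transitivity #|[set a * x; a * x + 1]|; last by rewrite cards2 nz.
by apply: eq_card => y; rewrite !inE.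
Qed.

(** For a in A the value of x is prescribed. Otherwise (m - a) x is - e a or 1 - e a, which leaves
    two solutions unless a = m. *)
Lemma arc_aff_slope_le a m c (e : F -> F) :
  (#|[pred x | arc_aff a (m * a + c)%R x (m * x + e a)%R]| <=
   if a \in A then 1 else if a == m then q else 2)%N.
Proof.
rewrite /arc_aff; case: ifP => aA; first by rewrite card1.
have [_|neq_am] := eqVneq a m; first exact: max_card.
have nz : m - a != 0 by rewrite subr_eq0 eq_sym.
apply: leq_trans (_ : #|[set - e a / (m - a); (1 - e a) / (m - a)]%R| <= _)%N.
  apply/subset_leq_card/subsetP=> x; rewrite !inE.
  case/orP=> /eqP E; apply/orP; [left | right]; apply/eqP;
    apply: (mulIf nz); rewrite divfK // mulrBr ![x * _]mulrC.
    by rewrite -E; ring.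
  have -> : 1 = m * x + e a - a * x by rewrite E addrC addKr.
  by ring.
by rewrite cards2; case: (_ != _).
Qed.

(** The first numerical hypothesis treats m in A, where the class at infinity adds at most [#|B|]
    points. The second treats m outside A: nothing is added at infinity, but column m counts q
    instead of 2, whence [n + 2]. *)
Lemma card_slope_le m c e k n (B : {set F}) :
  (forall m u v, Pinf m u v -> m \in A /\ v \in B) ->
  (#|A| + 2 * #|~: A| + #|B| <= n)%N ->
  (#|A| + 2 * #|~: A| + q <= n + 2)%N ->
  (#|[pred i | arc_point i && on_slope m c e k i]| <= n)%N.
Proof.
move=> PB leB leq'; rewrite !card_sum_pred /=.
rewrite [X in (_ + X)%N]eq_card0 ?addn0 => [|[u v]]; last first.
  by rewrite !inE andbF.
have leaff : (#|[pred p : F * F * F * F |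
   arc_point (inl (inl p)) && on_slope m c e k (inl (inl p))]| <=
   \sum_a if a \in A then 1 else if a == m then q else 2)%N.
  apply: leq_trans (_ : #|[pred p | arc_aff p.1 (m * p.1 + c)%R p.2
     (m * p.2 + e p.1)%R]| <= _)%N.
    apply: (@leq_card_cancel _ _ _ _ (fun p => (p.1.1.1, p.1.2))
      (fun p => (p.1, m * p.1 + c, p.2, m * p.2 + e p.1))).
    by move=> [[[a b] x] y] /= /and3P[ar /eqP <- /eqP <-].
  rewrite card_pair_pred; apply: leq_sum => a _.
  exact: arc_aff_slope_le.
have leinf : (#|[pred p : F * F * F |
   arc_point (inl (inr p)) && on_slope m c e k (inl (inr p))]| <=
   if m \in A then #|B| else 0)%N.
  case: ifP => mA; last first.
    rewrite eq_card0 // => -[[m' u] v] /=; rewrite !inE.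
    apply/negP=> /and3P[/PB[m'A _] /eqP E _].
    by rewrite E mA in m'A.
  apply: (@leq_card_cancel _ _ _ _ (fun p => p.2)
    (fun v => (m, k + c * v, v))).
  by move=> [[m' u] v] /= /and3P[/PB[_ vB] /eqP -> /eqP ->].
apply: leq_trans (leq_add leaff leinf) _.
rewrite (bigID (mem A)) /=.
have -> : (\sum_(a in A)
    (if a \in A then 1 else if a == m then q else 2) = #|A|)%N.
  by rewrite -sum1_card; apply: eq_bigr => a ->.
have EC : (\sum_(a | a \notin A) 2 = 2 * #|~: A|)%N.
  by rewrite mulnC -sum_nat_const; apply: eq_bigl => a; rewrite inE.
case: ifP => mA.
  rewrite (eq_bigr (fun _ => 2)) => [|a aA]; first by rewrite EC.
  by rewrite (negPf aA); case: eqP => // am; rewrite am mA in aA.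
have nmA : m \notin A by rewrite mA.
rewrite (bigD1 m) //= mA eqxx (eq_bigr (fun _ => 2)); last first.
  by move=> a /andP[/negPf-> /negPf->].
move: EC leB leq'; rewrite (bigD1 m) //=.
by move: (#|A|) (#|~: A|) (#|B|) (\sum_(_ | _) _)%N; lia.
Qed.

(** For a outside A, each b fixes x and so leaves two values of y. For a in A, at most two values of
    b solve the quadratic equation of the dual parabola, and each contributes at most q points. The
    remaining t points lie in x0. *)
Lemma card_vert_le a d k l n t :
  (forall a l, #|[pred v | P0 (l + a * v)%R v]| <= t)%N ->
  (2 * q + t <= n)%N ->
  (#|[pred i | arc_point i && on_vert a d k l i]| <= n)%N.
Proof.
move=> P0t len; rewrite !card_sum_pred /=.
rewrite [X in (_ + X + _)%N]eq_card0 ?addn0 => [|[[m u] v]]; last first.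
  by rewrite !inE andbF.
apply: leq_trans len; apply: leq_add; last first.
  apply: leq_trans (P0t a l).
  apply: (@leq_card_cancel _ _ _ _ snd (fun v => (l + a * v, v))).
  by move=> [u v] /= /andP[Puv /eqP Euv]; rewrite -Euv.
apply: leq_trans (_ : #|[pred p : F * F | arc_aff a p.1 (tau (d * p.1) + k)%R p.2]|
  <= _)%N.
  apply: (@leq_card_cancel _ _ _ _ (fun p => (p.1.1.2, p.2))
      (fun p => (a, p.1, tau (d * p.1) + k, p.2))).
  by move=> [[[a' b] x] y] /= /and3P[ar /eqP Ea /eqP <-]; rewrite -Ea.
rewrite card_pair_pred /arc_aff /=; have [aA|aA] := boolP (a \in A); last first.
  apply: leq_trans (_ : \sum_(b : F) 2 <= _)%N; last first.
    by rewrite sum_nat_const mulnC.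
  apply: leq_sum => b _.
  set x := _ + k; rewrite (_ : #|_| = #|[set a * x; a * x + 1]|).
    by rewrite cards2; case: (_ != _).
  by apply: eq_card => y; rewrite !inE.
set S := [set b | tau (d * b) + k == tau (b ^+ 2)].
have leS : (#|S| <= 2)%N.
  have [->|[b]] := set_0Vmem S; first by rewrite cards0.
  rewrite inE => /eqP bS.
  (* By injectivity of [tau], all solutions share the value of b^2 - d b, so the two roots sum to
     d. *)
  apply: leq_trans (_ : #|[set b; d - b]%R| <= 2)%N; last first.
    by rewrite cards2; case: (_ != _).
  apply/subset_leq_card/subsetP=> b'; rewrite !inE => /eqP b'S.
  have /tau_inj E : tau (b' ^+ 2 - d * b') = tau (b ^+ 2 - d * b).
    by rewrite !raddfB /= -b'S -bS ![tau _ + k]addrC !addrK.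
  have : (b' - b) * (b' - (d - b)) == 0.
    rewrite (_ : _ * _ = (b' ^+ 2 - d * b') - (b ^+ 2 - d * b)); last by ring.
    by rewrite E subrr.
  by rewrite mulf_eq0 !subr_eq0.
apply: leq_trans (_ : \sum_(b in S) q <= _)%N; last first.
  by rewrite sum_nat_const leq_mul2r leS orbT.
rewrite (bigID (mem S)) /= [X in (_ + X)%N]big1 ?addn0.
  by apply: leq_sum => b _; apply: max_card.
move=> b; rewrite inE => /negPf bS; apply: eq_card0 => y.
by rewrite !inE bS.
Qed.

Lemma card_far_le h e n :
  (\sum_m #|[pred u | Pinf m u (h m)]| + #|[pred u | P0 u e]| <= n)%N ->
  (#|[pred i | arc_point i && on_far h e i]| <= n)%N.
Proof.
move=> len; rewrite !card_sum_pred /=.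
rewrite [X in (X + _ + _)%N]eq_card0 ?add0n => [|[[[a b] x] y]]; last first.
  by rewrite !inE andbF.
apply: leq_trans len; apply: leq_add; last first.
  apply: (@leq_card_cancel _ _ _ _ fst (fun u => (u, e))).
  by move=> [u v] /= /andP[Puv /eqP Euv]; rewrite -Euv.
rewrite -(card_pair_pred (fun p => Pinf p.1 p.2 (h p.1))).
apply: (@leq_card_cancel _ _ _ _ (fun p => p.1) (fun p => (p, h p.1))).
by move=> [[m u] v] /= /andP[Puv /eqP Euv]; rewrite -Euv.
Qed.

End ArcCoordinates.

(** * Coordinates on the radical and on the ring *)

Section HjelmslevCoordinates.
Variables (R : finNzRingType) (N : {set R}).
Hypothesis chainN : chain_ring2 N.
Variables (F : finFieldType) (pi : {rmorphism R -> F}) (rho : F -> R).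
Hypothesis rhoK : cancel rho pi.
Hypothesis piN : forall x, (pi x == 0) = (x \in N).
Variable theta : R.
Hypothesis theta_neq0 : theta != 0.
Hypothesis theta_rad : theta \in N.
Hypothesis theta_genl : forall x, x \in N -> exists r, x = r * theta.
Hypothesis theta_genr : forall x, x \in N -> exists r, x = theta * r.

Lemma pi_rad x : x \in N -> pi x = 0.
Proof. by rewrite -piN => /eqP. Qed.

Lemma mul_theta_eq0 x : (x * theta == 0) = (x \in N).
Proof.
apply/eqP/idP=> [x0|Nx]; last exact: (rad_mul0 chainN).
apply: contraNT theta_neq0 => /(nonrad_inv chainN)[u ux _].
by rewrite -[theta]mul1r -ux -mulrA x0 mulr0.
Qed.

Lemma theta_mul_eq0 x : (theta * x == 0) = (x \in N).
Proof.
apply/eqP/idP=> [x0|Nx]; last exact: (rad_mul0 chainN).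
apply: contraNT theta_neq0 => /(nonrad_inv chainN)[u _ xu].
by rewrite -[theta]mulr1 -xu mulrA x0 mul0r.
Qed.

(** An additive bijection from F onto N, although [rho] is only a set-theoretic section: altering
    [rho a] by an element of N does not change the product, since N squares to 0. *)
Definition rad_of a := rho a * theta.
Definition rad_coord x := odflt 0 [pick a | rad_of a == x].

Lemma rad_of_rad a : rad_of a \in N. Proof. exact: (radMl chainN). Qed.

Lemma rad_of_pi x : rad_of (pi x) = x * theta.
Proof.
apply/eqP; rewrite -subr_eq0 -mulrBl mul_theta_eq0 -piN.
by rewrite rmorphB rhoK subrr.
Qed.

Lemma rad_of_inj : injective rad_of.
Proof.
move=> a b /eqP; rewrite -subr_eq0 -mulrBl mul_theta_eq0 -piN.
by rewrite rmorphB !rhoK subr_eq0 => /eqP.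
Qed.

Lemma rad_coordK x : x \in N -> rad_of (rad_coord x) = x.
Proof.
move=> /theta_genl[r ->]; rewrite /rad_coord; case: pickP => [a /eqP //|].
by move/(_ (pi r)); rewrite rad_of_pi eqxx.
Qed.

Lemma rad_ofD a b : rad_of (a + b) = rad_of a + rad_of b.
Proof. by rewrite -mulrDl -rad_of_pi rmorphD !rhoK. Qed.

Lemma mul_rad_of x a : x * rad_of a = rad_of (pi x * a).
Proof. by rewrite mulrA -rad_of_pi rmorphM rhoK. Qed.

Lemma rad_mul_rad_of x a : x \in N -> x * rad_of a = 0.
Proof. by move=> Nx; rewrite mul_rad_of pi_rad // mul0r -(rmorph0 pi) rad_of_pi mul0r. Qed.

(** The map of F that describes passing [theta] from the left of a scalar to its right. It plays the
    role of [tau]. *)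
Definition twist a := rad_coord (theta * rho a).

Lemma rad_of_twist x : rad_of (twist (pi x)) = theta * x.
Proof.
rewrite rad_coordK ?(radMr chainN) //; apply/eqP.
by rewrite -subr_eq0 -mulrBr theta_mul_eq0 -piN rmorphB rhoK subrr.
Qed.

Lemma twist_is_zmod_morphism : zmod_morphism twist.
Proof.
move=> a b; apply: rad_of_inj.
have E : rad_of (twist b) + rad_of (twist a - twist b) = rad_of (twist a).
  by rewrite -rad_ofD addrC subrK.
apply: (addrI (rad_of (twist b))); rewrite E -[a]rhoK -[b]rhoK -rmorphB.
by rewrite !rad_of_twist -mulrDr addrC subrK.
Qed.
HB.instance Definition _ :=
  GRing.isZmodMorphism.Build F F twist twist_is_zmod_morphism.

Lemma twist_inj : injective twist.
Proof.
move=> a b E; have : rad_of (twist a) = rad_of (twist b) by rewrite E.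
rewrite -[in LHS](rhoK a) -[in RHS](rhoK b) !rad_of_twist => /eqP.
rewrite -subr_eq0 -mulrBr theta_mul_eq0 -piN rmorphB !rhoK subr_eq0.
by move/eqP.
Qed.

Definition ring_coord a x := rho a + rad_of x.

Lemma pi_ring_coord a x : pi (ring_coord a x) = a.
Proof. by rewrite rmorphD rhoK pi_rad ?addr0 // rad_of_rad. Qed.

Lemma ring_coord_inj a x b y : ring_coord a x = ring_coord b y -> a = b /\ x = y.
Proof.
move=> E; have ab : a = b by rewrite -(pi_ring_coord a x) E pi_ring_coord.
by split=> //; move: E; rewrite /ring_coord ab => /addrI/rad_of_inj.
Qed.

(** * Homogeneous coordinates of points and traces of lines *)

Definition i0 : 'I_3 := @Ordinal 3 0 isT.
Definition i1 : 'I_3 := @Ordinal 3 1 isT.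
Definition i2 : 'I_3 := @Ordinal 3 2 isT.

Lemma ord3P (i : 'I_3) : [\/ i = i0, i = i1 | i = i2].
Proof.
case: i => -[|[|[|//]]] lti; [constructor 1 | constructor 2 | constructor 3];
  exact: val_inj.
Qed.

Definition vec3 (x y z : R) : vec R := \row_i nth 0 [:: x; y; z] i.

Lemma vec3E x y z :
  (vec3 x y z ord0 i0 = x) * (vec3 x y z ord0 i1 = y) * (vec3 x y z ord0 i2 = z).
Proof. by rewrite !mxE. Qed.

Lemma rmulE (v : vec R) r i : rmul v r ord0 i = v ord0 i * r.
Proof. by rewrite mxE. Qed.

Definition point_gen (i : hpoint F) : vec R :=
  match i with
  | inl (inl (a, b, x, y)) => vec3 (ring_coord a x) (ring_coord b y) 1
  | inl (inr (m, u, v)) => vec3 1 (ring_coord m u) (rad_of v)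
  | inr (u, v) => vec3 (rad_of u) 1 (rad_of v)
  end.

Lemma point_gen_free i : injective (rmul (point_gen i)).
Proof.
move=> r s E; have {}E k : point_gen i ord0 k * r = point_gen i ord0 k * s.
  by rewrite -!rmulE E.
case: i E => [[[[[a b] x] y]|[[m u] v]]|[u v]] E.
- by have := E i2; rewrite vec3E !mul1r.
- by have := E i0; rewrite vec3E !mul1r.
- by have := E i1; rewrite vec3E !mul1r.
Qed.

Lemma span1_id (v : vec R) : v \in span1 v.
Proof.
apply/imsetP; exists 1 => //; apply/rowP=> i.
by rewrite [RHS]rmulE mulr1.
Qed.

(** Generators of the same kind share a coordinate 1, which forces the scalar [r] to be 1. Different
    kinds would put 1 in N. *)
Lemma span1_point_gen_inj i j : span1 (point_gen i) = span1 (point_gen j) -> i = j.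
Proof.
move=> E; have := span1_id (point_gen i); rewrite E => /imsetP[r _ {}E].
have {}E k : point_gen i ord0 k = point_gen j ord0 k * r by rewrite E rmulE.
have N1 := negP (rad1 chainN); have Nl := rad_of_rad.
case: i j E => [[[[[a b] x] y]|[[m u] v]]|[u v]]
  [[[[[a' b'] x'] y']|[[m' u'] v']]|[u' v']] E;
  move: (E i0) (E i1) (E i2); rewrite !vec3E => {}E E1 E2.
- move: E2; rewrite mul1r => r1; move: E E1; rewrite -r1 !mulr1.
  by move=> /ring_coord_inj[-> ->] /ring_coord_inj[-> ->].
- by case: N1; rewrite E2 (radMr chainN).
- by case: N1; rewrite E2 (radMr chainN).
- by case: N1; rewrite E (radMl chainN) // -[r]mul1r -E2.
- move: E; rewrite mul1r => r1; move: E1 E2; rewrite -r1 !mulr1.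
  by move=> /ring_coord_inj[-> ->] /rad_of_inj->.
- by case: N1; rewrite E (radMr chainN).
- by case: N1; rewrite E1 (radMl chainN) // -[r]mul1r -E2.
- by case: N1; rewrite E1 (radMl chainN) // -[r]mul1r -E.
- move: E1; rewrite mul1r => r1; move: E E2; rewrite -r1 !mulr1.
  by move=> /rad_of_inj-> /rad_of_inj->.
Qed.

(** Since [rho] preserves neither sums nor products, the radical part of the equation contains a
    correction depending on a. This is why [on_slope] admits an arbitrary function [e]. *)
Lemma slope_line (L : {set vec R}) mu ka :
  (forall v, v \in L -> v ord0 i1 = mu * v ord0 i0 + ka * v ord0 i2) ->
  exists m c e k, forall i, point_gen i \in L -> on_slope m c e k i.
Proof.
move=> eqL; pose m := pi mu; pose c := pi ka.
pose e a := rad_coord (mu * rho a + ka - rho (m * a + c)).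
exists m, c, e, (rad_coord (mu - rho m)).
case=> [[[[[a b] x] y]|[[m' u] v]]|[u v]] /eqL; rewrite !vec3E ?mulr1.
- move=> E; have Eb : b = m * a + c.
    by rewrite -(pi_ring_coord b y) E rmorphD rmorphM pi_ring_coord.
  rewrite /= Eb eqxx /=; apply/eqP/rad_of_inj; rewrite rad_ofD rad_coordK.
    apply: (addrI (rho b)); rewrite [LHS]E /ring_coord mulrDr mul_rad_of Eb.
    by rewrite [RHS]addrCA subrKC addrAC addrC.
  by rewrite -piN rmorphB rmorphD rmorphM !rhoK subrr.
- move=> E; have Em : m' = m.
    rewrite -(pi_ring_coord m' u) E rmorphD rmorphM [pi (rad_of _)]pi_rad;
      last exact: rad_of_rad.
    by rewrite mulr0 addr0.
  rewrite /= Em eqxx /=; apply/eqP/rad_of_inj; rewrite rad_ofD rad_coordK.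
    by apply: (addrI (rho m')); rewrite [LHS]E Em mul_rad_of addrA subrKC.
  by rewrite -piN rmorphB !rhoK subrr.
- move=> E; have := rad1 chainN; rewrite E.
  by rewrite (radD chainN) // (radMl chainN) // rad_of_rad.
Qed.

(** Writing [de] as [theta * de'] turns [de * rho b] into the twisted product with d = [pi de']; the
    radical part of Y is annihilated by [de]. *)
Lemma vert_line (L : {set vec R}) de ka : de \in N ->
  (forall v, v \in L -> v ord0 i0 = de * v ord0 i1 + ka * v ord0 i2) ->
  exists a d k l, forall i, point_gen i \in L -> on_vert twist a d k l i.
Proof.
move=> Nde eqL; have [de' Ede] := theta_genr Nde.
pose a := pi ka; exists a, (pi de'), (rad_coord (ka - rho a)), (rad_coord de).
case=> [[[[[a' b] x] y]|[[m' u] v]]|[u v]] /eqL; rewrite !vec3E ?mulr1.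
- move=> E; have Ea : a' = a.
    by rewrite -(pi_ring_coord a' x) E rmorphD rmorphM (pi_rad Nde) mul0r add0r.
  rewrite /= Ea eqxx /=; apply/eqP/rad_of_inj; rewrite rad_ofD rad_coordK.
    apply: (addrI (rho a')); rewrite [LHS]E Ea /ring_coord mulrDr rad_mul_rad_of //.
    rewrite -{2}[b]rhoK -rmorphM rad_of_twist addr0 Ede mulrA.
    by rewrite addrCA subrKC.
  by rewrite -piN rmorphB !rhoK subrr.
- move=> E; have := rad1 chainN; rewrite E.
  rewrite (radD chainN) //; first exact: (radMr chainN).
  exact/(radMl chainN)/rad_of_rad.
- move=> E /=; apply/eqP/rad_of_inj; rewrite rad_ofD rad_coordK //.
  by rewrite E mul_rad_of.
Qed.

Lemma far_line (L : {set vec R}) de ep : de \in N -> ep \in N ->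
  (forall v, v \in L -> v ord0 i2 = de * v ord0 i0 + ep * v ord0 i1) ->
  exists h e, forall i, point_gen i \in L -> on_far h e i.
Proof.
move=> Nde Nep eqL.
exists (fun m => rad_coord (de + ep * rho m)), (rad_coord ep).
case=> [[[[[a' b] x] y]|[[m' u] v]]|[u v]] /eqL; rewrite !vec3E ?mulr1.
- move=> E; have := rad1 chainN; rewrite E.
  by rewrite (radD chainN) // (radMr chainN).
- move=> E /=; apply/eqP/rad_of_inj; rewrite rad_coordK.
    by rewrite E /ring_coord mulrDr rad_mul_rad_of // addr0.
  by rewrite (radD chainN) // (radMr chainN).
- move=> E /=; apply/eqP/rad_of_inj; rewrite rad_coordK // E.
  by rewrite rad_mul_rad_of // add0r.
Qed.

(** * Linear equations of lines and transfer of the arc to the plane *)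

Lemma common_zero_functional (x1 x2 x3 y1 y2 y3 u w : R) :
  u * x1 = 1 -> w * (y2 - x2 * (u * y1)) = 1 ->
  exists al be, al * x1 + be * x2 + x3 = 0 /\ al * y1 + be * y2 + y3 = 0.
Proof.
(* Elimination with left coefficients: [u] inverts the first pivot, [w] the pivot left in y after
   clearing its first coordinate; the third coefficient is normalised to 1. *)
move=> ux wy; set be := - (y3 - x3 * (u * y1)) * w.
exists (- (be * x2 + x3) * u), be; split.
  by rewrite -mulrA ux mulr1 opprD -addrA addrACA !addNr addr0.
have /eqP : be * (y2 - x2 * (u * y1)) = x3 * (u * y1) - y3.
  by rewrite /be -mulrA wy mulr1 opprB.
rewrite mulrBr subr_eq => /eqP ->.
rewrite -[X in X + _ + _]mulrA mulNr mulrDl -[be * x2 * _]mulrA -addrA.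
by rewrite [x3 * _ - _ + _]addrAC subrK [x3 * _ + _]addrC addNr.
Qed.

(** If all coordinates were in N, the nonzero scalar [theta] would annihilate the vector. *)
Lemma free_vec_unit (x : vec R) :
  (forall r, rmul x r = 0 -> r = 0) -> exists i, x ord0 i \notin N.
Proof.
move=> free; apply/existsP; rewrite -[X in is_true X]negbK negb_exists.
apply/negP=> /forallP xN; case/eqP: theta_neq0; apply: free; apply/rowP=> i.
by rewrite rmulE mxE; apply: (rad_mul0 chainN) => //; rewrite -[_ \in N]negbK.
Qed.

Lemma line_functional (L : {set vec R}) : is_line L ->
  exists al be ga, [|| be \notin N, al \notin N | ga \notin N] /\
    forall v, v \in L ->
      al * v ord0 i0 + be * v ord0 i1 + ga * v ord0 i2 = 0.
Proof.
case/existsP=> x /existsP[y /andP[/eqP-> /injectiveP inj_xy]].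
have free r s : rmul x r + rmul y s = 0 -> r = 0 /\ s = 0.
  move=> E; suff [-> ->] : (r, s) = (0, 0) by [].
  by apply: inj_xy; rewrite /= E; apply/rowP=> i; rewrite !mxE !mulr0 addr0.
have [i xi] : exists i, x ord0 i \notin N.
  apply: free_vec_unit => r E; case: (free r 0) => //; rewrite E add0r.
  by apply/rowP=> i; rewrite !mxE mulr0.
have [u ux xu] := nonrad_inv chainN xi.
(* Clearing coordinate i of y by a multiple of x keeps the vector free, so it has a unit coordinate
   j, necessarily different from i. The third index then receives coefficient 1. *)
have [j yj] : exists j, y ord0 j - x ord0 j * (u * y ord0 i) \notin N.
  pose y' : vec R := \row_j (y ord0 j - x ord0 j * (u * y ord0 i)).
  have [r E|j] := @free_vec_unit y'; last by rewrite mxE; exists j.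
  case: (free (- (u * y ord0 i * r)) r) => //; rewrite -E; apply/rowP=> j.
  by rewrite !mxE mulrBl mulrN addrC !mulrA.
have neq_ij : i != j.
  by apply: contraNneq yj => <-; rewrite mulrA xu mul1r subrr (rad0 chainN).
suff [al [be [ga [nz [Ex Ey]]]]] : exists al be ga,
    [|| be \notin N, al \notin N | ga \notin N] /\
    al * x ord0 i0 + be * x ord0 i1 + ga * x ord0 i2 = 0 /\
    al * y ord0 i0 + be * y ord0 i1 + ga * y ord0 i2 = 0.
  exists al, be, ga; split=> // v /imsetP[[r s] _ ->]; rewrite !mxE /= !mulrDr.
  rewrite [X in X + _]addrACA [LHS]addrACA !mulrA -!mulrDl.
  by rewrite Ex Ey !mul0r addr0.
have [w wy _] := nonrad_inv chainN yj.
have N1 := rad1 chainN.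
case: (ord3P i) (ord3P j) neq_ij ux wy => -> [] -> // _ ux wy.
- have [al [be [Ex Ey]]] := common_zero_functional (x ord0 i2) (y ord0 i2) ux wy.
  by exists al, be, 1; rewrite !mul1r N1 !orbT.
- have [al [ga [Ex Ey]]] := common_zero_functional (x ord0 i1) (y ord0 i1) ux wy.
  by exists al, 1, ga; rewrite !mul1r N1 [_ + _ + ga * _]addrAC Ex
    [_ + _ + ga * _]addrAC Ey.
- have [be [al [Ex Ey]]] := common_zero_functional (x ord0 i2) (y ord0 i2) ux wy.
  by exists al, be, 1; rewrite !mul1r N1 !orbT ![al * _ + _]addrC.
- have [be [ga [Ex Ey]]] := common_zero_functional (x ord0 i0) (y ord0 i0) ux wy.
  exists 1, be, ga; rewrite !mul1r N1 orbT; split=> //; split.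
    by rewrite -addrA addrC.
  by rewrite -addrA addrC.
- have [ga [al [Ex Ey]]] := common_zero_functional (x ord0 i1) (y ord0 i1) ux wy.
  by exists al, 1, ga; rewrite !mul1r N1; split=> //; split;
    rewrite addrC addrA.
- have [ga [be [Ex Ey]]] := common_zero_functional (x ord0 i0) (y ord0 i0) ux wy.
  by exists 1, be, ga; rewrite !mul1r N1 orbT; split=> //; split;
    rewrite -addrA addrC [be * _ + _]addrC.
Qed.

(** The equation is solved for Y if its coefficient is a unit, else for X, else for Z. This order
    places in N the coefficients that the last two shapes require there. *)
Lemma lineP (L : {set vec R}) : is_line L ->
  [\/ exists m c e k, forall i, point_gen i \in L -> on_slope m c e k i,
      exists a d k l, forall i, point_gen i \in L -> on_vert twist a d k l i
    | exists h e, forall i, point_gen i \in L -> on_far h e i].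
Proof.
move=> /line_functional[al [be [ga [nz eqL]]]].
have solve a b c u x y z : u * a = 1 -> a * x + b * y + c * z = 0 ->
    x = - (u * b) * y + - (u * c) * z.
  move=> ua E; rewrite -[x]mul1r -ua -mulrA.
  have -> : a * x = - (b * y) - (c * z).
    by apply/eqP; rewrite -opprD -addr_eq0 addrA E.
  by rewrite mulrBr mulrN !mulrA !mulNr.
have [Nbe|/(nonrad_inv chainN)[u ub _]] := boolP (be \in N); last first.
  constructor 1; apply: (@slope_line L (- (u * al)) (- (u * ga))) => v vL.
  by apply: solve ub _; rewrite [be * _ + _]addrC eqL.
have [Nal|/(nonrad_inv chainN)[u ua _]] := boolP (al \in N); last first.
  constructor 2; apply: (@vert_line L (- (u * be)) (- (u * ga))) => [|v vL].
    by rewrite (radN chainN) // (radMl chainN).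
  by apply: solve ua _; rewrite eqL.
move: nz; rewrite Nbe Nal /= => /(nonrad_inv chainN)[u ug _].
constructor 3; apply: (@far_line L (- (u * al)) (- (u * be))) => [||v vL].
- by rewrite (radN chainN) // (radMl chainN).
- by rewrite (radN chainN) // (radMl chainN).
- by apply: solve ug _; rewrite -addrA addrC eqL.
Qed.

(** Upper bounds on intersections suffice, so each line need only be contained in its trace on the
    coordinatised points. *)
Lemma arc_le_m_n (A : {set F}) Pinf P0 n :
  (forall m c e k, #|[pred i | arc_point twist A Pinf P0 i &&
     on_slope m c e k i]| <= n)%N ->
  (forall a d k l, #|[pred i | arc_point twist A Pinf P0 i &&
     on_vert twist a d k l i]| <= n)%N ->
  (forall h e, #|[pred i | arc_point twist A Pinf P0 i && on_far h e i]| <= n)%N ->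
  (#|arc_point twist A Pinf P0| <= m_n R n)%N.
Proof.
move=> len_slope len_vert len_far; set K := arc_point twist A Pinf P0.
pose S := [set span1 (point_gen i) | i in K].
have -> : #|K| = #|S|.
  by rewrite card_imset //; apply: span1_point_gen_inj.
apply: (@leq_bigmax_cond _ (fun S => proj_arc S n) (fun S => #|S|)).
apply/andP; split.
  apply/forallP=> P; apply/implyP=> /imsetP[i _ ->]; apply/existsP.
  by exists (point_gen i); rewrite eqxx /=; apply/injectiveP/point_gen_free.
apply/forallP=> L; apply/implyP=> Lline.
have boundL (inc : pred (hpoint F)) : (forall i, point_gen i \in L -> inc i) ->
    (#|[pred i | K i && inc i]| <= n -> #|[set P in S | P \subset L]| <= n)%N.
  move=> incL; apply: leq_trans.
  apply: leq_trans (_ : #|[set span1 (point_gen i) | i in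
     [pred i | K i && inc i]]| <= _)%N; last exact: leq_imset_card.
  apply/subset_leq_card/subsetP=> P; rewrite inE.
  case/andP=> /imsetP[i Ki ->] /subsetP sPL; apply: imset_f.
  by rewrite inE [K i]Ki incL // sPL // span1_id.
case: (lineP Lline) => [[m [c [e [k]]]]|[a [d [k [l]]]]|[h [e]]] /boundL; apply.
- exact: len_slope.
- exact: len_vert.
- exact: len_far.
Qed.

(** * Orders of N and R, and the lower bound with free parameters *)

Lemma card_rad : #|N| = #|F|.
Proof.
rewrite -cardsT -(card_imset _ rad_of_inj); apply: eq_card => x.
apply/idP/imsetP=> [Nx|[a _ ->]]; last exact: rad_of_rad.
by exists (rad_coord x); rewrite // rad_coordK.
Qed.

Lemma card_chain_ring : #|R| = (#|F| * #|F|)%N.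
Proof.
rewrite -card_prod; have inj : injective (fun p => ring_coord p.1 p.2).
  by move=> [a x] [b y] /= /ring_coord_inj[-> ->].
rewrite -(card_codom inj); apply: eq_card => x; rewrite [LHS]inE; symmetry.
apply/codomP; exists (pi x, rad_coord (x - rho (pi x))) => /=.
rewrite /ring_coord rad_coordK ?subrKC //.
by rewrite -piN rmorphB rhoK subrr.
Qed.

(** At infinity, each of the q - 2 segments (values of v in B) carries q points for slopes in A2 and
    t for slopes in A1. The class x0 carries E x C; on a vertical line v determines u, so at most
    [#|C|] = t of these points occur. The last hypothesis bounds the lines of class M. *)
Lemma m_n_ge (A A2 A1 B C E : {set F}) t :
  (#|A| + t + 2 = #|F|)%N -> (#|B| + 2 = #|F|)%N -> #|C| = t ->
  A2 \subset A -> A1 \subset A :\: A2 ->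
  (#|A2| * #|F| + #|A1| * t + #|E| <= 2 * #|F| + t)%N ->
  ((#|F| + t + 2) * #|F| ^ 2 + (#|A2| * #|F| + #|A1| * t) * #|B| + #|E| * t
   <= m_n R (2 * #|F| + t))%N.
Proof.
move=> cA cB cC sA2 sA1 leE.
pose D m := if m \in A2 then setT else if m \in A1 then C else set0.
have cD : (\sum_m #|D m| = #|A2| * #|F| + #|A1| * t)%N.
  rewrite (bigID (mem A2)) /=; congr addn.
    rewrite -[#|F|]cardsT -sum_nat_const; apply: eq_bigr => m mA2.
    by rewrite /D mA2.
  rewrite -cC -sum_nat_const (bigID (mem A1)) /= [X in (_ + X)%N]big1 ?addn0.
    apply: eq_big => [m|m /andP[/negPf mA2 mA1]]; last by rewrite /D mA2 mA1.
    rewrite andbC; have [mA1|//] := boolP (m \in A1).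
    by have := subsetP sA1 _ mA1; rewrite inE => /andP[-> _].
  by move=> m /andP[/negPf mA2 /negPf mA1]; rewrite /D mA2 mA1 cards0.
pose Pinf m u v := (u \in D m) && (v \in B).
pose P0 u v := (u \in E) && (v \in C).
have cAC : (#|A| + #|~: A| = #|F|)%N by rewrite cardsC.
have PinfAB m u v : Pinf m u v -> m \in A /\ v \in B.
  case/andP=> uD ->; split=> //; move: uD; rewrite /D.
  case: ifP => [/(subsetP sA2) //|_]; case: ifP => [/(subsetP sA1)|_].
    by rewrite inE => /andP[].
  by rewrite inE.
have P0t a l : (#|[pred v | P0 (l + a * v)%R v]| <= t)%N.
  by rewrite -cC; apply/subset_leq_card/subsetP=> v; rewrite inE => /andP[].
have leFar h e :
    (\sum_m #|[pred u | Pinf m u (h m)]| + #|[pred u | P0 u e]| <=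
     2 * #|F| + t)%N.
  apply: leq_trans leE; rewrite -cD; apply: leq_add.
    apply: leq_sum => m _; apply/subset_leq_card/subsetP=> u.
    by rewrite inE => /andP[].
  by apply/subset_leq_card/subsetP=> u; rewrite inE => /andP[].
have -> : ((#|F| + t + 2) * #|F| ^ 2 + (#|A2| * #|F| + #|A1| * t) * #|B| +
    #|E| * t = #|arc_point twist A Pinf P0|)%N.
  rewrite card_arc_point; congr (_ + _ + _)%N.
  - by congr muln; move: cA cAC; move: (#|A|) (#|~: A|); lia.
  - rewrite -cD big_distrl; apply: eq_bigr => m _ /=.
    rewrite -sum_nat_const big_mkcond; apply: eq_bigr => u _; rewrite /Pinf.
    by case: (u \in D m); [apply: eq_card | apply/esym/eq_card0].
  rewrite -cC -sum_nat_const big_mkcond; apply: eq_bigr => u _; rewrite /P0.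
  by case: (u \in E); [apply: eq_card | apply/esym/eq_card0].
apply: arc_le_m_n => [m c e k|a d k l|h e].
- apply: (@card_slope_le _ _ _ _ _ m c e k _ B) PinfAB _ _.
    by move: cA cB cAC; move: (#|A|) (#|~: A|) (#|B|); lia.
  by move: cA cAC; move: (#|A|) (#|~: A|); lia.
- exact: (@card_vert_le _ _ twist_inj _ _ _ a d k l _ t).
- exact: card_far_le.
Qed.

Lemma m_n_ge_cards s2 s1 e t :
  (s2 + s1 + t + 2 <= #|F|)%N -> (e <= #|F|)%N ->
  (s2 * #|F| + s1 * t + e <= 2 * #|F| + t)%N ->
  ((#|F| + t + 2) * #|F| ^ 2 + (s2 * #|F| + s1 * t) * (#|F| - 2) + e * t
   <= m_n R (2 * #|F| + t))%N.
Proof.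
move=> les lee lefar.
have exset k : (k <= #|F|)%N -> exists A : {set F}, #|A| = k.
  by rewrite -cardsT => /exists_subset_card[A _ cA]; exists A.
have [|A cA] := exset (#|F| - t - 2)%N; first by lia.
have [|B cB] := exset (#|F| - 2)%N; first by lia.
have [|C cC] := exset t; first by lia.
have [E cE] := exset e lee.
have [A2 sA2 cA2] : exists2 A2 : {set F}, A2 \subset A & #|A2| = s2.
  by apply: exists_subset_card; rewrite cA; lia.
have [A1 sA1 cA1] : exists2 A1 : {set F}, A1 \subset A :\: A2 & #|A1| = s1.
  apply: exists_subset_card; rewrite cardsD (setIidPr sA2) cA cA2; lia.
have := @m_n_ge A A2 A1 B C E t; rewrite cA cB cC cE cA2 cA1.
by apply=> //; lia.
Qed.

End HjelmslevCoordinates.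

(** * The four ranges of t *)

Theorem theorem3p3 (R : finNzRingType) (N : {set R}) (q t : nat) :
  chain_ring2 N ->
  #|R| = (q * #|N|)%N ->
  (t + 2 <= q)%N ->
  let n := (2 * q + t)%N in
  let m := ((m_n R n)%:Z : int) in
  let qz := (q%:Z : int) in let tz := (t%:Z : int) in let nz := (n%:Z : int) in
  [/\ tz <= qz - 5 -> qz * (qz + 1) * nz - qz ^+ 3 + 2 * qz ^+ 2 - 4 * qz - 2 * tz <= m,
      tz = qz - 4 -> qz * (qz + 1) * nz - qz ^+ 3 + 2 * qz ^+ 2 - 8 * qz + 16 <= m,
      tz = qz - 3 -> qz * (qz + 1) * nz - qz ^+ 3 + qz ^+ 2 - 2 * qz <= m
    & tz = qz - 2 -> qz * (qz + 1) * nz - qz ^+ 3 <= m].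
Proof.
move=> chainN cR letq n m qz tz nz.
have [F [pi [pi_surj piN]]] := residue_field chainN.
have [th [Nth nzth genl genr]] := rad_gen chainN.
pose rho a := odflt 0 [pick x | pi x == a].
have rhoK : cancel rho pi.
  move=> a; rewrite /rho; case: pickP => [x /eqP //|].
  by have [x <-] := pi_surj a => /(_ x); rewrite eqxx.
have cN := card_rad chainN rhoK piN nzth Nth genl.
have cF : #|F| = q.
  move: cR; rewrite cN (card_chain_ring chainN rhoK piN nzth Nth genl).
  by move/eqP; rewrite eqn_pmul2r => [/eqP //|]; apply/card_gt0P; exists 0.
have bound := m_n_ge_cards chainN rhoK piN nzth Nth genl genr.
rewrite cF in bound; move: bound; rewrite /m /nz /n /qz /tz => {m nz n qz tz}.
(* This removes the truncated subtraction q - 2 from the bound. *)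
have [b Eq] : exists b, q = b.+2 by exists (q - 2)%N; lia.
move: letq; rewrite {q cR cF}Eq => letb bound.
rewrite !exprS !expr0 !mulr1; split=> Et.
(* The arguments are the numbers of slopes with q and with t points per segment, then the size of E.
   With s = q - 2 - t slopes available, s >= 3 allows (2, 1, 0), reaching 2q + t on class M. For s =
   2, 1, 0 the choices are (2, 0, t), (1, 0, q) and (0, 0, q). *)
- have := @bound 2 1%N 0 t ltac:(lia) ltac:(lia) ltac:(lia); rewrite -mulnn;
  move: (m_n R _); nia.
- have := @bound 2 0 t t ltac:(lia) ltac:(lia) ltac:(lia); rewrite -mulnn;
  move: (m_n R _); nia.
- have := @bound 1%N 0 b.+2 t ltac:(lia) ltac:(lia) ltac:(lia); rewrite -mulnn;
  move: (m_n R _); nia.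
- have := @bound 0 0 b.+2 t ltac:(lia) ltac:(lia) ltac:(lia); rewrite -mulnn;
  move: (m_n R _); nia.
Qed.
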